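(* Let $\mathcal{H}$ and $\mathcal{K}$ be real Hilbert spaces, let $T \in \mathcal{B}(\mathcal{H},\mathcal{K})$ be an injective operator with closed range, and let $\mathrm{prox}_g\colon \mathcal{K}\to\mathcal{K}$ be the proximity operator on $\mathcal{K}$ of some $g \in \Gamma_0(\mathcal{K})$. Then $T^{\dagger} \, \mathrm{prox}_{g} \, T \colon \mathcal{H}_T \to \mathcal{H}_T$ is the proximity operator on $\mathcal{H}_T$ of the function $f \in \Gamma_0(\mathcal{H})$ given by $$f(x) := \Bigl( g \,\square\, \bigl( \tfrac12 \| \cdot \|_{\mathcal{K}}^2 + \iota_{\mathcal{N}(T^* )} \bigr)\Bigr) (Tx), \qquad x\in\mathcal{H},$$ where $\mathcal{N}(T^* )$ denotes the kernel of $T^*$. For bijective $T \in \mathcal{B}(\mathcal{H},\mathcal{K})$ this expression simplifies to $f(x) = g(Tx)$.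
   Context: $\mathcal{B}(\mathcal{H},\mathcal{K})$ denotes the bounded linear operators from $\mathcal{H}$ to $\mathcal{K}$ (with domain all of $\mathcal{H}$). For a real Hilbert space $X$ with norm $\|\cdot\|_X$, $\Gamma_0(X)$ is the set of proper, convex, lower semi-continuous functions $X \to (-\infty,\infty]$. For $h \in \Gamma_0(X)$ the proximity operator of $h$ on $X$ is $\mathrm{prox}_h\colon X \to X$, $\mathrm{prox}_h(x) = \operatorname{argmin}_{y \in X} \{ \frac12 \|x-y\|_X^2 + h(y) \}$ (the unique minimizer). The infimal convolution of $f_1,f_2 \in \Gamma_0(X)$ is $(f_1 \square f_2)(x) = \inf_{y \in X} \{ f_1(y) + f_2(x-y)\}$. The indicator function $\iota_S$ of a set $S$ takes the value $0$ on $S$ and $+\infty$ outside $S$. For injective $T \in \mathcal{B}(\mathcal{H},\mathcal{K})$ with closed range, the Moore-Penrose inverse is $T^\dagger = (T^*T)^{-1}T^* \in \mathcal{B}(\mathcal{K},\mathcal{H})$, where $T^*$ is the adjoint with respect to the original inner products of $\mathcal{H}$ and $\mathcal{K}$. $\mathcal{H}_T$ denotes the linear space $\mathcal{H}$ equipped with the inner product $\langle x,y\rangle_{\mathcal{H}_T} = \langle Tx,Ty\rangle_{\mathcal{K}}$ and norm $\|x\|_{\mathcal{H}_T} = \|Tx\|_{\mathcal{K}}$; this norm is equivalent to $\|\cdot\|_{\mathcal{H}}$, so $\mathcal{H}_T$ is a Hilbert space and $\Gamma_0(\mathcal{H}_T)=\Gamma_0(\mathcal{H})$. *)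

(* Defs.v *)
From HB Require Import structures.
From mathcomp Require Import all_boot all_order all_algebra.
From mathcomp Require Import all_classical all_reals all_analysis.

Set Implicit Arguments.
Unset Strict Implicit.
Unset Printing Implicit Defensive.

Import Order.TTheory GRing.Theory Num.Theory.
Import numFieldNormedType.Exports.

Local Open Scope classical_set_scope.
Local Open Scope ring_scope.

HB.mixin Record NormedModule_isInner (R : realType) H & NormedModule R H := {
  inner : {dot H for (idfun : R -> R)};
  innerxx : forall x : H, inner x x = `|x| ^+ 2
}.

#[short(type="hilbertType")]
HB.structure Definition Hilbert (R : realType) :=
  {H of CompleteNormedModule R H & NormedModule_isInner R H}.

(* The linear space [H] with the inner product [<T x, T y>], as a type of its
   own, so that its norm, topology and inner product differ from those of [H].
   Closedness of the range is what makes it complete. *)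
Definition renormed {R : realType} {H K : hilbertType R} (T : {linear H -> K})
  of injective T & closed (range T) : Type := H.

Section renormed_instances.
Context {R : realType} {H K : hilbertType R} (T : {linear H -> K}).
Hypotheses (injT : injective T) (clT : closed (range T)).
Local Notation HT := (renormed injT clT).

HB.instance Definition _ := GRing.Lmodule.copy HT H.

Definition renormed_norm (x : HT) : R := `|T x|.

Let renormed_normD x y :
  renormed_norm (x + y) <= renormed_norm x + renormed_norm y.
Proof. by rewrite /renormed_norm linearD ler_normD. Qed.

Let renormed_normZ (l : R) x :
  renormed_norm (l *: x) = `|l| * renormed_norm x.
Proof. by rewrite /renormed_norm linearZ normrZ. Qed.

Let renormed_norm_eq0 x : renormed_norm x = 0 -> x = 0.
Proof. by move/eqP; rewrite normr_eq0 => /eqP; rewrite -(linear0 T) => /injT. Qed.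

HB.instance Definition _ :=
  @Lmodule_isNormed.Build R HT renormed_norm
    renormed_normD renormed_normZ renormed_norm_eq0.

Lemma renormed_normE (x : HT) : `|x| = `|T x|.
Proof. by []. Qed.

Let renormed_complete (F : set_system HT) : ProperFilter F -> cauchy F -> cvg F.
Proof.
move=> FF cF.
have TF : ProperFilter ((T : HT -> K) @ F) by exact: fmap_proper_filter.
have /cauchy_cvg/cvg_ex[/= l Fl] : cauchy ((T : HT -> K) @ F).
  apply/cauchy_ballP => e e0; move/cauchy_ballP : cF.
  move=> /(_ e e0)[] [A B] /= [FA FB] AB.
  exists ((T @` A), (T @` B)).
    by split; [apply: filterS FA|apply: filterS FB] => x ?; exists x.
  move=> [_ _] [/= [x Ax <-] [y By <-]]; have := AB (x, y) (conj Ax By).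
  by rewrite -!ball_normE /= renormed_normE linearB.
have [x _ Tx] : range T l.
  by apply: (@closed_cvg _ _ F _ (T : HT -> K) _ clT _ l Fl); near=> x; exists x.
apply/cvg_ex; exists (x : HT); apply/cvgrPdist_lt => e e0.
move/cvgrPdist_lt : Fl => /(_ e e0); apply: filterS => y.
by rewrite renormed_normE linearB Tx.
Unshelve. all: by end_near. Qed.

HB.instance Definition _ := Uniform_isComplete.Build HT renormed_complete.

Definition renormed_inner (x y : HT) : R := inner (T x) (T y).

Let renormed_innerBl y : zmod_morphism (renormed_inner ^~ y).
Proof. by move=> u v; rewrite /renormed_inner linearB linearBl. Qed.
Let renormed_innerBr x : zmod_morphism (renormed_inner x).
Proof. by move=> u v; rewrite /renormed_inner linearB linearBr. Qed.
Let renormed_innerZl y : scalable_for *%R (renormed_inner ^~ y).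
Proof. by move=> a u; rewrite /renormed_inner linearZ linearZl_LR. Qed.
Let renormed_innerZr x :
  scalable_for ((idfun : R -> R) \; *%R) (renormed_inner x).
Proof. by move=> a u; rewrite /renormed_inner linearZ linearZr. Qed.

HB.instance Definition _ := @isBilinear.Build R HT HT R
  *%R ((idfun : R -> R) \; *%R) renormed_inner
  renormed_innerBl renormed_innerBr renormed_innerZl renormed_innerZr.

Let renormed_inner_herm x y :
  renormed_inner x y = (-1) ^+ false * (idfun : R -> R) (renormed_inner y x).
Proof. exact: hermC. Qed.

HB.instance Definition _ :=
  @isHermitianSesquilinear.Build R HT false idfun
    renormed_inner renormed_inner_herm.

Let renormed_inner_gt0 x : x != 0 -> 0 < renormed_inner x x.
Proof.
by move=> x0; apply: neq0_dnorm_gt0; rewrite raddf_eq0.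
Qed.

HB.instance Definition _ := @isDotProduct.Build R HT renormed_inner
    renormed_inner_gt0.

Let renormed_innerxx x : renormed_inner x x = `|x| ^+ 2.
Proof. exact: innerxx. Qed.

HB.instance Definition _ := @NormedModule_isInner.Build R HT renormed_inner
    renormed_innerxx.

Lemma renormed_innerE (x y : HT) : inner x y = inner (T x) (T y).
Proof. by []. Qed.

End renormed_instances.

Definition bounded_operator {R : realType} {H K : hilbertType R}
    (T : {linear H -> K}) : Prop :=
  exists M : R, forall x, `|T x| <= M * `|x|.

(* [adjoint] and [moore_penrose] are total functions: the adjoint is the
   expected one for bounded [T] (Riesz), and the inverse of [T^* T] is a true
   inverse when moreover [T] is injective with closed range. *)
Definition adjoint {R : realType} {H K : hilbertType R} (T : H -> K) (y : K) : H :=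
  get [set z : H | forall x, inner (T x) y = inner x z].

Definition moore_penrose {R : realType} {H K : hilbertType R} (T : H -> K) :
    K -> H :=
  pinv [set: H] (adjoint T \o T) \o adjoint T.

Section convex_analysis.
Context {R : realType} {X : hilbertType R}.
Implicit Types (h : X -> \bar R) (x y p : X).
Local Open Scope ereal_scope.

(* In the convexity inequality, [0 * +oo = 0]. *)
Definition Gamma0 : set (X -> \bar R) := [set h |
  [/\ forall x, h x != -oo,
      exists x, h x < +oo,
      forall x y (t : R), (0 <= t <= 1)%R ->
        h (t *: x + (1 - t) *: y)%R <= t%:E * h x + (1 - t)%:E * h y
    & lower_semicontinuous h]].

Definition prox_argmin h x : set X := [set p | forall y,
  (2^-1 * `|x - p| ^+ 2)%:E + h p <= (2^-1 * `|x - y| ^+ 2)%:E + h y].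

Definition prox h : X -> X := fun x => get (prox_argmin h x).

(* For [h] in [Gamma0], [is_prox h P] says that [P x] is the one and only
   minimizer for every [x]; this determines [P] and entails [P = prox h]. *)
Definition is_prox h (P : X -> X) : Prop :=
  Gamma0 h /\ forall x, prox_argmin h x = [set P x].

Lemma is_prox_eq h P : is_prox h P -> P = prox h.
Proof.
case=> _ hP; apply/funext => x; have := hP x; rewrite /prox => ->.
by symmetry; apply: (@getI _ [set P x] (P x)).
Qed.

Definition infconv (h1 h2 : X -> \bar R) : X -> \bar R :=
  fun x => ereal_inf [set h1 y + h2 (x - y)%R | y in [set: X]].

Definition indicator (S : set X) : X -> \bar R :=
  fun x => if x \in S then 0 else +oo.

End convex_analysis.

Arguments Gamma0 {R} X.

(* Main.v *)
Require Import Defs.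
From mathcomp Require Import all_boot all_order all_algebra.
From mathcomp Require Import all_classical all_reals all_analysis.
From mathcomp Require Import ring lra.

(** Write [V = range T], a closed subspace of [K], and [P] for the orthogonal
    projection onto it.  By definition [f x = F (T x)], where [F u] is the
    infimum of [g y + |u - y|^2 / 2] over the fibre [u + V^perp] of [P].

    The formula for the proximity operator is Pythagoras.  If [u] and [v] lie in
    [V] and [y] in the fibre of [v], then
    [|u - y|^2 = |u - v|^2 + |v - y|^2].  Hence minimizing
    [|T x - v|^2 / 2 + F v] over [v] in [V] amounts to minimizing
    [|T x - y|^2 / 2 + g y] over all of [K]: the minimizer is [q = prox g (T x)]
    and the optimal [v] is [P q = T (moore_penrose T q)].  Since the norm of
    [H_T] is [|T x|], this is the claim ([prox_objective_pythagoras]).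

    The work lies in showing that [F] composed with [T] belongs to [Gamma0] and
    that the minimizers, adjoints and projections involved exist.  All of it
    rests on one compactness statement, [nested_midconvex_nonempty]: in a Hilbert
    space, a decreasing sequence of nonempty bounded closed convex sets has a
    common point.  This replaces weak compactness.  Applied to sublevel sets of
    [y |-> |x - y|^2 / 2 + h y], which are bounded because [h] has a minorant
    [- A - B |y|], it gives [prox_objective_compact], with three consequences:
    - [prox_argmin_exists]: every [h] in [Gamma0] has proximal points.  For [h]
      the opposite of a bounded linear functional this is Riesz' theorem
      [riesz].  Riesz in [H] provides the adjoint, and Riesz in [H_T], applied
      to [x |-> <T x, y>], provides the projection of [y] onto [V];
    - [fiber_inf_attained]: the infimum defining [F] is attained, from which
      convexity of [F] follows;
    - [fiber_inf_lsc]: [F] is lower semicontinuous on [V].  The near-minimizers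
      for points of [V] close to [u] lie in slightly thickened fibres of [u],
      and the thickened fibres shrink to the fibre of [u].

    If [T] is bijective then [V^perp = 0], every fibre is a single point, and
    [F = g]. *)

Set Implicit Arguments.
Unset Strict Implicit.
Unset Printing Implicit Defensive.

Import Order.TTheory GRing.Theory Num.Theory.
Import numFieldNormedType.Exports.

Local Open Scope classical_set_scope.
Local Open Scope ring_scope.

(** * Inner products and nested convex sets *)

Section inner_product.
Context {R : realType} {X : hilbertType R}.
Implicit Types x y z u v : X.

Lemma innerC x y : inner x y = inner y x.
Proof. by rewrite hermC expr0 mul1r. Qed.

Lemma innerZl (a : R) x y : inner (a *: x) y = a * inner x y.
Proof. exact: linearZl_LR. Qed.

Lemma innerZr (a : R) x y : inner x (a *: y) = a * inner x y.
Proof. by rewrite innerC innerZl innerC. Qed.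

Lemma sqr_normD x y : `|x + y| ^+ 2 = `|x| ^+ 2 + 2 * inner x y + `|y| ^+ 2.
Proof.
rewrite -!innerxx linearDl !linearDr /= (innerC y x); lra.
Qed.

Lemma sqr_normB x y : `|x - y| ^+ 2 = `|x| ^+ 2 - 2 * inner x y + `|y| ^+ 2.
Proof. by rewrite sqr_normD linearNr normrN; lra. Qed.

(** The last term is the strong convexity of the squared norm: it makes
    near-minimizers close to each other and minimizers unique. *)
Lemma sqr_norm_convex x y (t : R) :
  `|t *: x + (1 - t) *: y| ^+ 2 =
  t * `|x| ^+ 2 + (1 - t) * `|y| ^+ 2 - t * (1 - t) * `|x - y| ^+ 2.
Proof.
rewrite sqr_normB sqr_normD !normrZ !exprMn !real_normK ?num_real//.
rewrite innerZl innerZr; ring.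
Qed.

(** Expanding [0 <= | |y| x - |x| y |^2] and dividing by [|x| |y|]. *)
Lemma inner_le x y : inner x y <= `|x| * `|y|.
Proof.
have [->|x0] := eqVneq x 0; first by rewrite linear0l normr0 mul0r.
have [->|y0] := eqVneq y 0; first by rewrite linear0r normr0 mulr0.
have xy0 : 0 < `|x| * `|y| by rewrite mulr_gt0 ?normr_gt0.
have : 0 <= `| `|y| *: x - `|x| *: y| ^+ 2 by [].
rewrite sqr_normB !normrZ !exprMn !normr_id innerZl innerZr.
rewrite -(ler_pM2l xy0); lra.
Qed.

Lemma norm_inner_le x y : `|inner x y| <= `|x| * `|y|.
Proof.
rewrite ler_norml inner_le andbT -[leLHS]mulNr.
by have := inner_le (- x) y; rewrite normrN linearNl /=; lra.
Qed.

Lemma continuous_innerr x : continuous (inner x : X -> R).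
Proof.
move=> y; apply/cvgrPdist_lt => e e0.
have d0 : 0 < e / (`|x| + 1) by rewrite divr_gt0 // ltr_wpDl.
near=> z.
have yz : `|y - z| < e / (`|x| + 1).
  by near: z; apply: cvgr_dist_lt => //; exact: cvg_id.
rewrite -linearBr (le_lt_trans (norm_inner_le _ _))//.
rewrite ltr_pdivlMr ?ltr_wpDl// in yz.
have := normr_ge0 (y - z); nra.
Unshelve. all: by end_near. Qed.

Definition orthocomplement (V : set X) : set X :=
  [set z | forall v, V v -> inner v z = 0].

(** Midpoints suffice for all uses of convexity of sets below. *)
Definition midconvex (C : set X) :=
  forall x y, C x -> C y -> C (2^-1 *: x + (1 - 2^-1) *: y).

Lemma midconvexI (C D : set X) : midconvex C -> midconvex D ->
  midconvex (C `&` D).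
Proof. by move=> cC cD x y [? ?] [? ?]; split; [exact: cC|exact: cD]. Qed.

(** Almost minimize the norm on each [C n], by [y n].  The minimal norms increase
    to a finite limit.  For large [m] and [n] the midpoint of [y m] and [y n] still
    lies in an early [C N], so its norm cannot be much below that limit, and the
    strong convexity of the squared norm forces [y m] and [y n] to be close. *)
Lemma nested_midconvex_nonempty (C : nat -> set X) (M : R) :
  (forall n, closed (C n)) -> (forall n, midconvex (C n)) ->
  (forall m n, (m <= n)%N -> C n `<=` C m) ->
  (forall n, C n !=set0) -> (forall n x, C n x -> `|x| <= M) ->
  exists x, forall n, C n x.
Proof.
move=> clC cC decC C0 bC.
pose S n := [set `|x| ^+ 2 | x in C n]; pose m n := inf (S n).
have infS n : has_inf (S n).
  split; first by case: (C0 n) => x Cx; exists (`|x| ^+ 2); exists x.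
  by exists 0 => _ [x _ <-].
have mle n x : C n x -> m n <= `|x| ^+ 2.
  by move=> Cx; apply: ge_inf; [exact: (infS n).2|exists x].
have /choice[y yP] : forall n, exists y,
    C n y /\ `|y| ^+ 2 < m n + n.+1%:R^-1.
  move=> n.
  have /(@inf_adherent _ (S n)) : (0 < n.+1%:R^-1 :> R) by [].
  by move=> /(_ (infS n))[_ [x Cx <-] ?]; exists x.
have supm : has_sup (range m).
  split; first by exists (m 0), 0.
  exists (M ^+ 2) => _ [n _ <-].
  have [x Cx] := C0 n; apply: le_trans (mle _ _ Cx) _.
  by rewrite lerXn2r ?nnegrE ?(le_trans (normr_ge0 x)) ?(bC n).
have m_sup n : m n <= sup (range m) by apply: ub_le_sup; [exact: supm.2|exists n].
have cauchy_y : cauchy (y @ \oo).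
  apply: cauchy_exP => e e0.
  (* The midpoint estimate gives |y N - y k|^2 / 4 < 2 d, hence d = e^2 / 8. *)
  have d0 : 0 < e ^+ 2 / 8 by rewrite divr_gt0 ?exprn_gt0.
  have [_ [N1 _ <-] mN1] := sup_adherent d0 supm.
  have [N2 _ N2P] := near_infty_natSinv_lt (PosNum d0).
  have mono i j : (i <= j)%N -> m i <= m j.
    by move=> ij; apply: lb_le_inf; [exact: (infS j).1|
      move=> _ [x Cx <-]; apply: mle; exact: decC Cx].
  pose N := maxn N1 N2; exists (y N), N => // k /= Nk.
  have [CN yN] := yP N; have [Ck yk] := yP k.
  have := mle N _ (cC _ _ _ CN (decC _ _ Nk _ Ck)).
  rewrite sqr_norm_convex -ball_normE /= => mid.
  have := mono _ _ (leq_maxl N1 N2); have := m_sup N; have := m_sup k.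
  have := N2P N (leq_maxr N1 N2); have := N2P k (leq_trans (leq_maxr N1 N2) Nk).
  rewrite /= -/N => *.
  rewrite -(ltr_pXn2r (ltn0Sn 1)) ?nnegrE// ?ltW//.
  have {}yN : `|y N| ^+ 2 < m N + e ^+ 2 / 8
    by apply: lt_trans yN _; rewrite ltrD2l.
  have {}yk : `|y k| ^+ 2 < m k + e ^+ 2 / 8
    by apply: lt_trans yk _; rewrite ltrD2l.
  move: mid yN yk; rewrite !exprS !expr0. lra.
have /cvg_ex[/= x yx] : cvg (y @ \oo) by exact: cauchy_cvg.
exists x => n; apply: (@closed_cvg _ _ \oo _ y _ (clC n) _ x yx).
exists n => // k /= nk; exact: decC nk _ (yP k).1.
Qed.

End inner_product.

(** * Existence and uniqueness of proximal points *)

Section gamma0.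
Context {R : realType} {X : hilbertType R}.
Implicit Types (h : X -> \bar R) (x y z p : X).

(** Lower semicontinuity bounds [h] below on a small ball around a point [x0]
    where [h] is finite.  For [y] outside the ball, convexity on the segment from
    [x0] to [y], which meets the ball, lets [h] decrease at most linearly in the
    distance. *)
Lemma Gamma0_minorant h : Gamma0 X h ->
  exists A B : R, [/\ 0 <= A, 0 <= B & forall y, ((- (A + B * `|y|))%:E <= h y)%E].
Proof.
case=> hNy [x0 hx0] hconv hlsc.
have [r0 hr0] : exists r, h x0 = r%:E.
  by case: (h x0) hx0 (hNy x0) => [r| |] // _ _; exists r.
have [V /nbhs_ballP[d /= d0 dV] hV] : exists2 V, nbhs x0 V &
    forall y, V y -> ((r0 - 1)%:E < h y)%E.
  by apply: hlsc; rewrite hr0 lte_fin; lra.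
have hd z : `|x0 - z| < d -> ((r0 - 1)%:E < h z)%E.
  by move=> zd; apply/hV/dV; rewrite -ball_normE.
have dNd : 0 < d^-1 by rewrite invr_gt0.
exists (`|r0| + 1 + 2 * `|x0| / d), (2 / d); split.
- by rewrite !addr_ge0// divr_ge0 ?mulr_ge0// ltW.
- by rewrite divr_ge0// ltW.
move=> y; pose s := `|x0 - y|.
have sy : s / d <= (`|x0| + `|y|) / d.
  by rewrite ler_pM2r// -(normrN y) ler_normD.
have r0n : - `|r0| <= r0 by rewrite lerNl -normrN ler_norm.
have r0y : 0 <= `|x0| / d by rewrite divr_ge0// ltW.
have yd : 0 <= `|y| / d by rewrite divr_ge0// ltW.
case: (h y) (hNy y) (hd y) (hconv y x0) => [r| |] // _; last by rewrite leey.
rewrite hr0 lee_fin lte_fin -/s => hdy hc.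
have [/hdy sd|ds] := ltP s d; first lra.
have s0 : 0 < s by exact: lt_le_trans ds.
(* This t puts t y + (1 - t) x0 at distance d / 2 from x0. *)
pose t := d / (2 * s).
have t0 : 0 < t by rewrite divr_gt0// mulr_gt0.
have t1 : t <= 1 by rewrite ler_pdivrMr ?mulr_gt0//; lra.
have := hc t; rewrite (ltW t0) t1 => /(_ isT).
have := hd (t *: y + (1 - t) *: x0).
have -> : x0 - (t *: y + (1 - t) *: x0) = t *: (x0 - y).
  rewrite scalerBr scalerBl scale1r opprD opprB addrCA (addrCA x0).
  by rewrite subrr addr0 addrC.
rewrite normrZ gtr0_norm// -/s.
have -> : t * s = d / 2 by rewrite /t; field; rewrite gt_eqF.
move=> /(_ ltac:(lra)) /lt_le_trans /[apply].
rewrite -!EFinM -EFinD lte_fin => tr.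
have : t^-1 * (t * r0 - 1) < t^-1 * (t * r) by rewrite ltr_pM2l ?invr_gt0//; lra.
rewrite mulrBr !mulKf ?gt_eqF// mulr1 /t invf_div -/s; lra.
Qed.

Definition prox_objective h x y : \bar R := ((2^-1 * `|x - y| ^+ 2)%:E + h y)%E.

(** The quadratic term beats the linear minorant of [h]. *)
Lemma prox_objective_coercive h x (a : R) : Gamma0 X h ->
  exists M : R, forall y, (prox_objective h x y <= a%:E)%E -> `|y| <= M.
Proof.
move=> /Gamma0_minorant[A [B [A0 B0 hAB]]].
pose b := 2 * `|x| + 2 * B; pose c := 2 * `|a| + 2 * A.
exists (b + c + 1) => y; rewrite /prox_objective.
case: (h y) (hAB y) => [r| |] //; rewrite !lee_fin => hr obj.
have xy : `|y| - `|x| <= `|x - y| by rewrite lerBlDl distrC -{1}(subrKC x y) ler_normD.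
have ax : a <= `|a| by exact: ler_norm.
have {}xy : `|y| ^+ 2 - 2 * `|x| * `|y| <= `|x - y| ^+ 2.
  have := normr_ge0 (x - y); have := normr_ge0 x; have := normr_ge0 y.
  by have [? ? ? ?|? ? ? ?] := leP `|x| `|y|; nra.
(* If the bound b + c + 1 were exceeded, |y| ^ 2 > b |y| + c would follow. *)
have sq : `|y| ^+ 2 <= b * `|y| + c by rewrite /b /c; lra.
have b0 : 0 <= b by rewrite addr_ge0// mulr_ge0.
have c0 : 0 <= c by rewrite addr_ge0// mulr_ge0.
rewrite leNgt; apply/negP => yM.
have y1 : 1 < `|y| by apply: le_lt_trans yM; lra.
suff : b * `|y| + c < `|y| ^+ 2 by rewrite ltNge sq.
rewrite expr2; nra.
Qed.

Lemma prox_objective_midpoint h x (a : R) p q : Gamma0 X h ->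
  (prox_objective h x p <= a%:E)%E -> (prox_objective h x q <= a%:E)%E ->
  (prox_objective h x (2^-1 *: p + (1 - 2^-1) *: q)%R
     <= (a - 8^-1 * `|p - q| ^+ 2)%:E)%E.
Proof.
case=> hNy _ hconv _; rewrite /prox_objective.
have /= := hconv p q 2^-1; set z := (X in h X).
case: (h p) (hNy p) => [r| |]//; case: (h q) (hNy q) => [s| |]// _ _.
rewrite !lee_fin -!EFinM -EFinD => /(_ ltac:(lra)).
have -> : x - z = 2^-1 *: (x - p) + (1 - 2^-1) *: (x - q).
  rewrite !scalerBr addrACA -scalerDl -opprD; congr (_ - _).
  by rewrite addrC subrK scale1r.
rewrite sqr_norm_convex.
have -> : x - p - (x - q) = - (p - q) by rewrite !opprB addrC addrA subrK.
rewrite normrN.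
case: (h z) => [m| |]; rewrite ?leye_eq ?addeNy ?leNye// -EFinD !lee_fin; lra.
Qed.

Lemma prox_objective_lsc h x : Gamma0 X h ->
  lower_semicontinuous (prox_objective h x).
Proof.
case=> hNy _ _ hlsc y c; rewrite /prox_objective => cy.
set q := fun z : X => 2^-1 * `|x - z| ^+ 2 : R.
have qcont : q z @[z --> y] --> q y.
  apply: cvgM; first exact: cvg_cst.
  apply: cvgM; apply: cvg_norm; apply: cvgB; by [exact: cvg_cst|exact: cvg_id].
have [b bq bh] : exists2 b : R, c < q y + b & (b%:E < h y)%E.
  case: (h y) cy (hNy y) => [r| |] // cy _; last first.
    by exists (c - q y + 1); rewrite ?ltry//; lra.
  move: cy; rewrite -EFinD lte_fin -/(q y) => cy.
  by exists ((r + (c - q y)) / 2); rewrite ?lte_fin; lra.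
have [V yV hV] := hlsc y b bh.
have e0 : 0 < q y + b - c by lra.
exists (V `&` [set z | `|q y - q z| < q y + b - c]).
  by apply: filterI => //; move/cvgrPdist_lt : qcont => /(_ _ e0).
move=> z [Vz /= qz].
have := hV z Vz; case: (h z) => [r| |]; first last.
- by rewrite ltNge leNye.
- by move=> _; exact: ltry.
rewrite -EFinD !lte_fin -/(q z); move: qz; rewrite ltr_norml => /andP[? ?]; lra.
Qed.

Lemma closed_lsc_sublevel (Y : topologicalType) (E : Y -> \bar R) (a : R) :
  lower_semicontinuous E -> closed [set y | (E y <= a%:E)%E].
Proof.
move=> /lower_semicontinuousP /(_ a); rewrite -closedC.
by congr closed; apply/seteqP; split=> y /=; rewrite leNgt => /negP.
Qed.

(** The existence principle behind proximal points, attained infima over fibres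
    and lower semicontinuity.  The sublevel sets at height [a + 1 / (n + 1)],
    intersected with the constraint sets [D n], are nested, closed, convex and
    bounded; a common point satisfies all constraints and has value at most
    [a]. *)
Lemma prox_objective_compact h x (D : nat -> set X) (a : R) : Gamma0 X h ->
  (forall n, closed (D n)) -> (forall n, midconvex (D n)) ->
  (forall m n, (m <= n)%N -> D n `<=` D m) ->
  (forall n (e : R), 0 < e ->
    exists2 y, D n y & (prox_objective h x y <= (a + e)%:E)%E) ->
  exists2 y, forall n, D n y & (prox_objective h x y <= a%:E)%E.
Proof.
move=> Gh clD cD decD Da.
pose S n := [set y | (prox_objective h x y <= (a + n.+1%:R^-1)%:E)%E].
have [M hM] := prox_objective_coercive x (a + 1) Gh.
have lsc_obj : lower_semicontinuous (prox_objective h x).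
  exact: prox_objective_lsc.
have Sle m n : (m <= n)%N -> S n `<=` S m.
  move=> mn y /=; rewrite /S /= => /le_trans; apply.
  by rewrite lee_fin lerD2l lef_pV2 ?posrE// ler_nat.
have [|||||y Sy] := @nested_midconvex_nonempty _ _ (fun n => D n `&` S n) M.
- move=> n; apply: closedI => //.
  exact: closed_lsc_sublevel lsc_obj.

- move=> n; apply: midconvexI => // p q Sp Sq.
  apply: le_trans (prox_objective_midpoint Gh Sp Sq) _.
  by rewrite lee_fin gerBl mulr_ge0.
- by move=> m n mn; apply: setISS; [exact: decD|exact: Sle].
- by move=> n; have [|y] := Da n n.+1%:R^-1; [|exists y].
- by move=> n y [_ /(Sle _ _ (leq0n n))]; rewrite /S /= invr1 => /hM.
exists y => [n|]; first by have [] := Sy n.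
apply/lee_addgt0Pr => e e0.
have [N _ NP] := near_infty_natSinv_lt (PosNum e0).
apply: le_trans (Sy N).2 _.
by rewrite -EFinD lee_fin lerD2l; apply/ltW/NP => /=.
Qed.

Lemma prox_argmin_exists h x : Gamma0 X h -> exists p, prox_argmin h x p.
Proof.
move=> Gh; pose m := ereal_inf [set prox_objective h x y | y in [set: X]].
have mle y : (m <= prox_objective h x y)%E by apply: ereal_inf_lbound; exists y.
suff [p mp] : exists p, (prox_objective h x p <= m)%E.
  by exists p => y; apply: le_trans (mle y).
have [A [B [A0 B0 hAB]]] := Gamma0_minorant Gh.
have [hNy [x0 hx0] _ _] := Gh.
have [M hM] := prox_objective_coercive x 0 Gh.
have mlt (c : R) : (m < c%:E)%E -> exists2 y, True & (prox_objective h x y <= c%:E)%E.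
  by move=> /ereal_inf_lt[_ [y _ <-]] /ltW ?; exists y.
have [r mr] : exists r, m = r%:E.
  case E : m mlt (mle x0) => [r| |] mlt m0; first by exists r.
    by move: m0 hx0; rewrite leye_eq /prox_objective; case: (h x0) (hNy x0).
  (* An infimum of -oo would give a point whose value lies below the bound that
     the minorant yields on the sublevel set at height 0. *)
  pose c := Order.min (-1) (- (A + B * M) - 1).
  have [y _ yc] := mlt c (ltNyr _).
  have yM : `|y| <= M.
    apply: hM; apply: le_trans yc _.
    by rewrite lee_fin /c ge_min; apply/orP; left; lra.
  have cM : c <= - (A + B * M) - 1 by rewrite /c ge_min lexx orbT.
  have yB : B * `|y| <= B * M by rewrite ler_wpM2l.
  have q0 : 0 <= 2^-1 * `|x - y| ^+ 2 by rewrite mulr_ge0.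
  exfalso; move: yc (hAB y); rewrite /prox_objective.
  by case: (h y) => [s| |] //; rewrite !lee_fin; lra.
have [||||p _ pm] := @prox_objective_compact h x (fun=> setT) r Gh.
- by move=> _; exact: closedT.
- by [].
- by [].
- by move=> _ e e0; have [|y _ yr] := mlt (r + e); [rewrite mr lte_fin; lra|exists y].
by exists p; rewrite mr.
Qed.

(** At the midpoint of two minimizers at distance [d], the objective would be
    smaller than the minimum by [d ^ 2 / 8]. *)
Lemma prox_argmin_unique h x p q : Gamma0 X h ->
  prox_argmin h x p -> prox_argmin h x q -> p = q.
Proof.
move=> Gh minp minq; have [hNy [x0 hx0] _ _] := Gh.
have [r pr] : exists r, prox_objective h x p = r%:E.
  have := minp x0; rewrite -!/(prox_objective _ _ _) {2}/prox_objective.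
  rewrite /prox_objective.
  case: (h x0) hx0 (hNy x0) => [s| |]//; case: (h p) (hNy p) => [t| |]// *.
  by eexists; rewrite -EFinD.
have qr : (prox_objective h x q <= r%:E)%E by rewrite -pr; exact: minq.
have pr' : (prox_objective h x p <= r%:E)%E by rewrite pr.
have := le_trans (minp _) (prox_objective_midpoint Gh pr' qr).
rewrite -/(prox_objective _ _ _) pr lee_fin => pq.
have : `|p - q| ^+ 2 <= 0 by lra.
by rewrite -[leRHS](expr0n _ 2) ler_pXn2r ?nnegrE// normr_le0 subr_eq0 => /eqP.
Qed.

Lemma prox_argmin_prox h x : Gamma0 X h -> prox_argmin h x (prox h x).
Proof. by move=> Gh; have [p hp] := prox_argmin_exists x Gh; exact: getI hp. Qed.

End gamma0.

(** * Riesz representation, adjoint and orthogonal projection *)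

Section riesz.
Context {R : realType} {X : hilbertType R}.
Implicit Types (x y z : X).

Lemma Gamma0_functional (l : X -> R) :
  (forall (a : R) x y, l (a *: x + y) = a * l x + l y) -> continuous l ->
  Gamma0 X (EFin \o l).
Proof.
move=> lin lcont; split => //= [|x y t _|x a].
- by exists 0; exact: ltry.
- rewrite lin -[(1 - t) *: y]addr0 lin -!EFinM -EFinD lee_fin.
  have -> : l 0 = 0 by have := lin (-1) 0 0; rewrite scaler0 addr0; lra.
  by rewrite addr0.
rewrite lte_fin => alx; have e0 : 0 < l x - a by lra.
exists [set y | `|l x - l y| < l x - a].
  by have /cvgrPdist_lt/(_ _ e0) := lcont x.
by move=> y /=; rewrite lte_fin ltr_norml => /andP[? ?]; lra.
Qed.

(** The representing vector [z] minimizes [|y|^2 / 2 - l y], so it is the proximal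
    point at [0] of [- l]; the stationarity condition in each direction [x] is
    [<x, z> = l x]. *)
Lemma riesz (l : X -> R) :
  (forall (a : R) x y, l (a *: x + y) = a * l x + l y) ->
  (exists M : R, forall x, `|l x| <= M * `|x|) ->
  exists z, forall x, l x = inner x z.
Proof.
move=> lin [M lM].
have lB x y : l (x - y) = l x - l y.
  by rewrite addrC -scaleN1r lin; ring.
have lcont : continuous l.
  move=> x; apply/cvgrPdist_lt => e e0.
  have d0 : 0 < e / (`|M| + 1) by rewrite divr_gt0// ltr_wpDl.
  near=> y.
  have : `|x - y| < e / (`|M| + 1).
    by near: y; apply: cvgr_dist_lt => //; exact: cvg_id.
  rewrite ltr_pdivlMr ?ltr_wpDl// -lB.
  have := lM (x - y); have := normr_ge0 (x - y); have := ler_norm M; nra.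
have Gl : Gamma0 X (EFin \o (fun x => - l x)).
  apply: Gamma0_functional => [a x y|x]; first by rewrite lin; lra.
  by apply: cvgN; exact: lcont.
have [z minz] := prox_argmin_exists 0 Gl.
exists z => x.
have key (t : R) : 0 <= 2 * t * (inner x z - l x) + t ^+ 2 * `|x| ^+ 2.
  have := minz (t *: x + z); rewrite /= -!EFinD lee_fin !sub0r !normrN lin.
  rewrite sqr_normD normrZ exprMn real_normK ?num_real// innerZl; lra.
apply/eqP; rewrite eq_sym -subr_eq0; apply/eqP; set d := inner x z - l x in key *.
set N := `|x| ^+ 2 in key *.
have [N0|N0] := eqVneq N 0.
  have := key (- d); rewrite N0 mulr0 addr0 => dd.
  by apply/eqP; rewrite -sqrf_eq0 eq_le sqr_ge0 andbT expr2; lra.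
have Np : 0 < N by rewrite lt_def N0 sqr_ge0.
(* This step minimizes the quadratic polynomial in t of [key]. *)
have := key (- d / N).
have -> : 2 * (- d / N) * d + (- d / N) ^+ 2 * N = - (d ^+ 2 / N) by field.
rewrite oppr_ge0 pmulr_lle0 ?invr_gt0// => d0.
by apply/eqP; rewrite -sqrf_eq0 eq_le d0 sqr_ge0.
Unshelve. all: by end_near. Qed.

End riesz.

Section operators.
Context {R : realType} {H K : hilbertType R} (T : {linear H -> K}).

Lemma bounded_operator_continuous : bounded_operator T -> continuous T.
Proof.
move=> [M TM] x; apply/cvgrPdist_lt => e e0.
have d0 : 0 < e / (`|M| + 1) by rewrite divr_gt0// ltr_wpDl.
near=> y.
have : `|x - y| < e / (`|M| + 1).
  by near: y; apply: cvgr_dist_lt => //; exact: cvg_id.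
rewrite ltr_pdivlMr ?ltr_wpDl// -linearB.
have := TM (x - y); have := normr_ge0 (x - y); have := ler_norm M; nra.
Unshelve. all: by end_near. Qed.

Lemma adjointP : bounded_operator T ->
  forall x y, inner (T x) y = inner x (adjoint T y).
Proof.
move=> [M TM] x y; rewrite /adjoint.
have : exists z : H, forall x, inner (T x) y = inner x z.
  apply: riesz => [a u v|]; first by rewrite linearP linearDl /= innerZl.
  exists (M * `|y|) => u; apply: le_trans (norm_inner_le _ _) _.
  by rewrite mulrAC ler_wpM2r.
move=> /cid[z hz].
exact: (@getI _ [set z | forall x, inner (T x) y = inner x z] z hz).
Qed.

Lemma adjoint_ker : bounded_operator T ->
  [set z | adjoint T z = 0] = orthocomplement (range T).
Proof.
move=> bT; apply/seteqP; split=> z /=.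
  by move=> Tz _ [x _ <-]; rewrite adjointP// Tz linear0r.
move=> Tz; apply/eqP; rewrite -normr_eq0 -sqrf_eq0 -innerxx -adjointP//.
by apply/eqP; apply: Tz; exists (adjoint T z).
Qed.

(** Riesz in [renormed injT clT], applied to [u |-> <T u, y>], gives [x] with
    [<T u, y> = <T u, T x>] for all [u]: [T x] is the projection of [y] onto the
    range.  The same identity says [T^* y = T^* T x], and [T^* T] is injective, so
    [x] is the value of the Moore-Penrose inverse at [y]. *)
Lemma moore_penrose_orthogonal :
  bounded_operator T -> injective T -> closed (range T) ->
  forall y, orthocomplement (range T) (y - T (moore_penrose T y)).
Proof.
move=> bT injT clT y.
have [x Tx] : exists x : H, forall u : H, inner (T u) y = inner (T u) (T x).
  (* In the norm |T u| this functional is bounded by |y|, by Cauchy-Schwarz in K. *)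
  apply: (@riesz R (renormed injT clT) (fun u => inner (T u) y)).
    by move=> a u v; rewrite linearP linearDl /= innerZl.
  by exists `|y| => u; rewrite mulrC; exact: norm_inner_le.
have TTx : adjoint T y = (adjoint T \o T) x.
  apply/eqP; rewrite -subr_eq0 -normr_eq0 -sqrf_eq0 -innerxx linearBr /=.
  by rewrite -!adjointP// Tx subrr.
have TTinj : {in [set: H] &, injective (adjoint T \o T)}.
  move=> u v _ _ /= uv; apply/injT/eqP.
  rewrite -subr_eq0 -normr_eq0 -sqrf_eq0 -innerxx -{1}linearB linearBr /=.
  by rewrite !adjointP// uv subrr.
have -> : moore_penrose T y = x.
  rewrite /moore_penrose /= TTx; apply: pinvKV TTinj _ _.
  by rewrite inE.
by move=> _ [u _ <-]; rewrite linearBr /= Tx subrr.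
Qed.

End operators.

(** * Infima over the fibres of an orthogonal projection *)

Section fiber_infimum.
Context {R : realType} {K : hilbertType R}.
Implicit Types (g : K -> \bar R) (V : set K) (u v y : K).

Definition fiber_inf g V u : \bar R :=
  ereal_inf (prox_objective g u @` [set y | orthocomplement V (u - y)]).

Lemma infconv_fiber_inf g V u : (forall y, g y != -oo%E) ->
  infconv g (fun y => (2^-1 * `|y| ^+ 2)%:E + indicator (orthocomplement V) y)%E u
    = fiber_inf g V u.
Proof.
move=> gNy; apply/eqP; rewrite eq_le; apply/andP; split.
  apply: le_ereal_inf_tmp => _ [y /= uy <-]; apply: ereal_inf_lbound.
  by exists y => //=; rewrite /indicator mem_set// adde0 addeC.
apply: le_ereal_inf_tmp => _ [y _ <-]; rewrite /indicator.
case: ifPn => [/set_mem uy|_].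
  by rewrite adde0 addeC; apply: ereal_inf_lbound; exists y.
by rewrite addey ?leey.
Qed.

Lemma prox_objective_pythagoras g V u v y :
  V (u - v) -> orthocomplement V (v - y) ->
  prox_objective g u y = ((2^-1 * `|u - v| ^+ 2)%:E + prox_objective g v y)%E.
Proof.
move=> uv vy; rewrite /prox_objective addeA -EFinD.
by rewrite -(subrKA v u (- y)) (sqr_normD (u - v)) (vy _ uv) mulr0 addr0 mulrDr.
Qed.

(** For [u] in a subspace [V], the set in question is the fibre of [u] thickened by
    [e]: the points whose projection onto [V] is within [e] of [u].  As an
    intersection of half-spaces, it is closed and convex. *)
Lemma midconvex_near_orthogonal V u (e : R) :
  midconvex [set y | forall v, V v -> inner v (y - u) <= e * `|v|].
Proof.
move=> p q hp hq v Vv /=.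
have -> : 2^-1 *: p + (1 - 2^-1) *: q - u =
          2^-1 *: (p - u) + (1 - 2^-1) *: (q - u).
  rewrite !scalerBr addrACA -opprD -scalerDl.
  by rewrite [2^-1 + _]addrC subrK scale1r.
by rewrite linearDr /= !innerZr; have := hp v Vv; have := hq v Vv; lra.
Qed.

Lemma closed_near_orthogonal V u (e : R) :
  closed [set y | forall v, V v -> inner v (y - u) <= e * `|v|].
Proof.
have -> : [set y | forall v, V v -> inner v (y - u) <= e * `|v|] =
    \bigcap_(v in V) (fun y => inner v (y - u) : R) @^-1` [set r | r <= e * `|v|].
  by apply/seteqP; split=> y /= hy v Vv; exact: hy.
apply: closed_bigI => v _; apply: preimage_closed; last exact: closed_le.
move=> y _; apply: (@continuous_comp _ _ _ (fun z => z - u) (inner v : K -> R)).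
  by apply: cvgB; [exact: cvg_id|exact: cvg_cst].
exact: continuous_innerr.
Qed.

(** Let [v] in [V] be close to [u] and [y] in its fibre.  Then [y] lies in a thin
    thickening of the fibre of [u], and by Pythagoras its objective at [u] exceeds
    that at [v] by [|u - v|^2 / 2] only.  By compactness some point lies in all
    thickenings, that is in the fibre of [u].  The case [v = u] says that the
    infimum is attained, the general case that it is lower semicontinuous. *)
Lemma fiber_inf_approx g V u (a : R) : Gamma0 K g ->
  (forall v w, V v -> V w -> V (v - w)) -> V u ->
  (forall e : R, 0 < e -> exists2 v, V v /\ `|u - v| <= e &
     (fiber_inf g V v < (a + e)%:E)%E) ->
  exists2 y, orthocomplement V (u - y) & (prox_objective g u y <= a%:E)%E.
Proof.
move=> Gg VB Vu approx.
have V0 : V 0 by rewrite -(subrr u); exact: VB.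
have VN v : V v -> V (- v) by rewrite -sub0r; exact: VB.
pose D n := [set y | forall v, V v -> inner v (y - u) <= n.+1%:R^-1 * `|v|].
have [||m n mn y Dy v Vv|n e e0|y Dy ya] := @prox_objective_compact _ _ g u D a Gg.
- by move=> n; exact: closed_near_orthogonal.
- by move=> n; exact: midconvex_near_orthogonal.
- apply: le_trans (Dy v Vv) _.
  by rewrite ler_wpM2r// lef_pV2 ?posrE// ler_nat.
(* d <= 1 / (n + 1) puts y into D n; d <= e / 2 and d <= 1 bound the error
   d^2 / 2 + d by e. *)
- pose d := Order.min (Order.min n.+1%:R^-1 (e / 2)) 1 : R.
  have d0 : 0 < d by rewrite !lt_min ltr01 divr_gt0// invr_gt0 ltr0n.
  have [v [Vv uv]] := approx d d0.
  move=> /ereal_inf_lt[_ [y /= vy <-]] ya.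
  exists y => [w Vw|].
    rewrite -(subrKA v y (- u)) linearDr /= -(opprB v y) linearNr /= vy//.
    rewrite oppr0 add0r.
    apply: le_trans (inner_le _ _) _.
    rewrite mulrC ler_wpM2r// distrC (le_trans uv)//.
    by rewrite /d !ge_min lexx.
  rewrite (prox_objective_pythagoras g (VB _ _ Vu Vv) vy).
  have -> : a + e = e / 2 + (a + e / 2) by lra.
  rewrite EFinD leeD//.
    rewrite lee_fin.
    have d1 : d <= 1 by rewrite /d ge_min lexx orbT.
    have de : d <= e / 2 by rewrite /d !ge_min lexx orbT.
    have := normr_ge0 (u - v); nra.
  apply: le_trans (ltW ya) _; rewrite lee_fin lerD2l.
  by rewrite /d !ge_min lexx orbT.
exists y => // v Vv.
have le0 w : V w -> inner w (y - u) <= 0.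
  move=> Vw; rewrite leNgt; apply/negP => yw.
  have w0 : 0 < `|w| + 1 by rewrite ltr_wpDl.
  have [N _ NP] := near_infty_natSinv_lt (PosNum (divr_gt0 yw w0)).
  have := NP N (leqnn N).
  rewrite /= ltr_pdivlMr// => /lt_le_trans /(_ (Dy N w Vw)).
  by rewrite mulrDr mulr1 gtrDl invr_lt0 ltrn0.
rewrite -(opprB y u) linearNr /=.
by have := le0 v Vv; have := le0 _ (VN v Vv); rewrite linearNl /=; lra.
Qed.

Lemma fiber_inf_attained g V u (a : R) : Gamma0 K g ->
  (forall v w, V v -> V w -> V (v - w)) -> V u -> (fiber_inf g V u <= a%:E)%E ->
  exists2 y, orthocomplement V (u - y) & (prox_objective g u y <= a%:E)%E.
Proof.
move=> Gg VB Vu Fu; apply: fiber_inf_approx => // e e0; exists u.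
  by rewrite subrr normr0 ltW.
by apply: le_lt_trans Fu _; rewrite lte_fin ltrDl.
Qed.

Lemma fiber_inf_le g V u y (b : \bar R) : orthocomplement V (u - y) ->
  (prox_objective g u y <= b)%E -> (fiber_inf g V u <= b)%E.
Proof.
by move=> uy yb; apply: ge_ereal_inf; exists (prox_objective g u y) => //; exists y.
Qed.

Lemma fiber_inf_lsc g V u (a : R) : Gamma0 K g ->
  (forall v w, V v -> V w -> V (v - w)) -> V u -> (a%:E < fiber_inf g V u)%E ->
  exists2 e : R, 0 < e &
    forall v, V v -> `|u - v| < e -> (a%:E < fiber_inf g V v)%E.
Proof.
move=> Gg VB Vu au; apply: contrapT => noe.
have [|y uy ya] := @fiber_inf_approx g V u a Gg VB Vu.
  move=> e e0; apply: contrapT => nov; apply: noe; exists e => // v Vv uv.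
  rewrite ltNge; apply/negP => va; apply: nov; exists v; first by rewrite ltW.
  by apply: le_lt_trans va _; rewrite lte_fin ltrDl.
by have := fiber_inf_le uy ya; rewrite leNgt au.
Qed.

Lemma prox_objective_joint_convex g u v p q (a b t : R) : Gamma0 K g ->
  0 <= t <= 1 -> (prox_objective g u p <= a%:E)%E ->
  (prox_objective g v q <= b%:E)%E ->
  (prox_objective g (t *: u + (1 - t) *: v)%R (t *: p + (1 - t) *: q)%R
     <= (t * a + (1 - t) * b)%:E)%E.
Proof.
case=> gNy _ gconv _ t01; rewrite /prox_objective.
have /= := gconv p q t t01; set z := (X in g X).
case: (g p) (gNy p) => [r| |]//; case: (g q) (gNy q) => [s| |]// _ _.
rewrite !lee_fin -!EFinM -EFinD.
have -> : t *: u + (1 - t) *: v - z = t *: (u - p) + (1 - t) *: (v - q).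
  by rewrite opprD addrACA !scalerBr.
rewrite sqr_norm_convex; move/andP: t01 => [t0 t1].
have := sqr_ge0 (`|u - p - (v - q)|).
set N := _ ^+ 2; set P := `|u - p| ^+ 2; set Q := `|v - q| ^+ 2.
case: (g z) => [m| |]; rewrite ?leye_eq ?addeNy ?leNye// -EFinD !lee_fin.
move=> N0 mrs Pa Qb.
have : 0 <= t * (1 - t) * N by rewrite !mulr_ge0// subr_ge0.
nra.
Qed.

End fiber_infimum.

(** Convexity of an extended real-valued function can be checked on real upper
    bounds of its values, that is on its epigraph. *)
Lemma convex_ineq_epigraph {R : realType} {X : lmodType R} (h : X -> \bar R) :
  (forall x, h x != -oo%E) ->
  (forall x y (a b t : R), 0 <= t <= 1 -> (h x <= a%:E)%E -> (h y <= b%:E)%E ->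
    (h (t *: x + (1 - t) *: y)%R <= (t * a + (1 - t) * b)%:E)%E) ->
  forall x y (t : R), 0 <= t <= 1 ->
    (h (t *: x + (1 - t) *: y)%R <= t%:E * h x + (1 - t)%:E * h y)%E.
Proof.
move=> hNy hepi x y t t01.
have [->|t0] := eqVneq t 0.
  by rewrite scale0r add0r subr0 scale1r mul0e mul1e add0e.
have [->|t1] := eqVneq t 1.
  by rewrite subrr scale0r addr0 scale1r mul0e mul1e adde0.
have tp : 0 < t by move/andP: t01 => [? _]; rewrite lt_def t0.
have tq : 0 < 1 - t by move/andP: t01 => [_ ?]; rewrite subr_gt0 lt_def eq_sym t1.
move: (hepi x y); case: (h x) (hNy x) => [a| |]// _; last first.
  move=> _; rewrite gt0_muley ?lte_fin// addye ?leey//.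
  by case: (h y) (hNy y) => [b| |]// _; rewrite ?gt0_muley ?lte_fin.
case: (h y) (hNy y) => [b| |]// _ hab; last first.
  by rewrite [X in (_ + X)%E]gt0_muley ?lte_fin// addey// leey.
by rewrite -!EFinM -EFinD; exact: hab.
Qed.

(** * The proximity operator on the renormed space *)

Section composition.
Context {R : realType} {X K : hilbertType R} (T : {linear X -> K}).
Context (g : K -> \bar R) (Gg : Gamma0 K g).

Lemma range_linear_subr v w : range T v -> range T w -> range T (v - w).
Proof. by move=> [x _ <-] [y _ <-]; exists (x - y) => //; rewrite linearB. Qed.

Lemma fiber_inf_gtNy V u : fiber_inf g V u != -oo%E.
Proof.
have [p minp] := prox_argmin_exists u Gg; have [gNy _ _ _] := Gg.
have : (prox_objective g u p <= fiber_inf g V u)%E.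
  by apply: le_ereal_inf_tmp => _ [y _ <-]; exact: minp.
apply: contraTneq => ->.
by rewrite /prox_objective leeNy_eq adde_eq_ninfty negb_or gNy.
Qed.

(** Stated for an arbitrary Hilbert space [X] because it serves twice: for the
    original norm and for the norm [|T x|]. *)
Lemma Gamma0_fiber_inf_comp : continuous T ->
  (forall y, exists x, orthocomplement (range T) (y - T x)) ->
  Gamma0 X (fun x => fiber_inf g (range T) (T x)).
Proof.
move=> Tcont Tproj; have rB := range_linear_subr.
have rT x : range T (T x) by exists x.
split => [x||x y t t01|x a ax].
- exact: fiber_inf_gtNy.
- have [_ [y0 gy0] _ _] := Gg; have [x yx] := Tproj y0.
  exists x; apply: (@le_lt_trans _ _ (prox_objective g (T x) y0)).
    apply: fiber_inf_le (lexx _) => v Vv.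
    by rewrite -(opprB y0) linearNr /= yx// oppr0.
  by rewrite /prox_objective lte_add_pinfty// ltry.
- apply: (@convex_ineq_epigraph _ _ (fun x => fiber_inf g (range T) (T x))) => //.
    by move=> z; exact: fiber_inf_gtNy.
  move=> {x y t t01} x y a b t t01 xa yb.
  have [p xp pa] := fiber_inf_attained Gg rB (rT x) xa.
  have [q yq qb] := fiber_inf_attained Gg rB (rT y) yb.
  rewrite linearD !linearZ /=.
  apply: fiber_inf_le (prox_objective_joint_convex Gg t01 pa qb) => v Vv.
  rewrite opprD addrACA -!scalerBr linearDr /= !innerZr.
  by rewrite (xp v Vv) (yq v Vv) !mulr0 addr0.
- have [e e0 he] := fiber_inf_lsc Gg rB (rT x) ax.
  exists (T @^-1` [set v | `|T x - v| < e]).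
    by have /cvgrPdist_lt/(_ _ e0) := Tcont x.
  by move=> y; exact: he.
Qed.

End composition.

Theorem theorem3p2 (R : realType) (H K : hilbertType R) (T : {linear H -> K})
    (bndT : bounded_operator T) (injT : injective T) (clT : closed (range T))
    (g : K -> \bar R) (Gg : Gamma0 K g) :
  let HT : hilbertType R := renormed injT clT in
  let f : H -> \bar R := fun x =>
    infconv g
      (fun y => ((2^-1 * `|y| ^+ 2)%:E + indicator [set z | adjoint T z = 0%R] y)%E)
      (T x) in
  [/\ Gamma0 H f,
      @is_prox R HT f (moore_penrose T \o prox g \o T)
    & bijective T -> forall x, f x = g (T x)].
Proof.
move=> HT f; have gNy : forall y, g y != -oo%E by case: Gg.
have -> : f = fun x => fiber_inf g (range T) (T x).
  by apply/funext => x; rewrite /f adjoint_ker// infconv_fiber_inf.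
have Tproj y : orthocomplement (range T) (y - T (moore_penrose T y)).
  exact: moore_penrose_orthogonal.
have rT x : range T (T x) by exists x.
have rB := @range_linear_subr _ _ _ T.
split.
- apply: Gamma0_fiber_inf_comp => //; first exact: bounded_operator_continuous.
  by move=> y; exists (moore_penrose T y).
(* A minimizer is unique because f is in Gamma0, so it is enough that
   T^dagger q is one: the objective at q is a lower bound for all z, and the
   value at T^dagger q does not exceed it. *)
- have GHT : Gamma0 HT (fun x => fiber_inf g (range T) (T x)).
    apply: (@Gamma0_fiber_inf_comp R HT K (T : {linear HT -> K}) g Gg).
      apply: bounded_operator_continuous; exists 1 => x.
      by rewrite mul1r renormed_normE.
    by move=> y; exists (moore_penrose T y).
  split=> // x; set q := prox g (T x).
  suff minp : prox_argmin (X := HT) (fun x => fiber_inf g (range T) (T x)) x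
      (moore_penrose T q).
    apply/seteqP; split=> [z minz|z ->//] /=.
    exact: prox_argmin_unique GHT minz minp.
  have minq : prox_argmin g (T x) q by exact: prox_argmin_prox.
  have qp := Tproj q; set p := moore_penrose T q in qp *.
  move=> z; apply: (@le_trans _ _ (prox_objective g (T x) q)).
    rewrite (@prox_objective_pythagoras _ _ g (range T) _ (T p)); last 2 first.
    + exact: rB.
    + by move=> v Vv; rewrite -(opprB q) linearNr /= qp// oppr0.
    rewrite renormed_normE linearB leeD2l//.
    apply: fiber_inf_le (lexx _) => v Vv.
    by rewrite -(opprB q) linearNr /= qp// oppr0.
  rewrite -leeBlDl// renormed_normE linearB.
  apply: le_ereal_inf_tmp => _ [y /= zy <-]; rewrite EFinN leeBlDl//.
  rewrite -(prox_objective_pythagoras g _ zy); first exact: minq.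
  exact: rB.
(* T being onto, a vector orthogonal to the range is orthogonal to itself. *)
- case=> S TS ST x; apply/eqP; rewrite eq_le; apply/andP; split.
    apply: (@fiber_inf_le _ _ g (range T) (T x) (T x)).
      by move=> v _; rewrite subrr linear0r.
    by rewrite /prox_objective subrr normr0 expr0n mulr0 add0e.
  apply: le_ereal_inf_tmp => _ [y /= xy <-].
  have /eqP : inner (T x - y) (T x - y) = 0 by apply: xy; exists (S (T x - y)).
  rewrite innerxx sqrf_eq0 normr_eq0 subr_eq0 => /eqP <-.
  by rewrite /prox_objective subrr normr0 expr0n mulr0 add0e.
Qed.
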